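(* Let $B$ be a semialgebraic subset of $\mathbb{C}$, let $n\geq 1$, and let $\mathcal{C}_n(B)\subset\mathbb{R}^n$ be the set of all $(a_0,\ldots,a_{n-1})\in\mathbb{R}^n$ such that all (complex) roots of the real monic polynomial $p(z)=z^n+a_{n-1}z^{n-1}+\cdots+a_1z+a_0$ belong to $B$. Then $\mathcal{C}_n(B)$ is a semialgebraic subset of $\mathbb{R}^n$.
   Context: A subset of $\mathbb{R}^m$ is semialgebraic if it belongs to the smallest family of subsets of $\mathbb{R}^m$ that is closed under finite unions, finite intersections and complements and contains all sets $\{\mathbf{x}\in\mathbb{R}^m : P(\mathbf{x})>0\}$ with $P\in\mathbb{R}[x_1,\ldots,x_m]$. A subset of $\mathbb{C}^m$ is called semialgebraic if it is semialgebraic in $\mathbb{R}^{2m}$ after the standard identification $\mathbb{C}^m\cong\mathbb{R}^{2m}$ (real and imaginary parts). *)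

(* Defs.v *)
From mathcomp Require Import all_boot all_order all_algebra.
From mathcomp Require Import mpoly.
From mathcomp Require Import complex.
From mathcomp Require Import classical_sets reals.

Set Implicit Arguments.
Unset Strict Implicit.
Unset Printing Implicit Defensive.

Import Order.TTheory GRing.Theory Num.Theory.

Local Open Scope ring_scope.
Local Open Scope classical_set_scope.
Local Open Scope complex_scope.

(* The smallest family of subsets of R^m containing the sets {P > 0} and
   closed under finite Boolean operations.  The empty union and the empty
   intersection are covered by [semialg_pos] with [P = 0] and [P = 1]. *)
Inductive semialgebraic (R : realType) (m : nat) : set 'rV[R]_m -> Prop :=
| semialg_pos (P : {mpoly R[m]}) :
    semialgebraic [set x : 'rV[R]_m | 0 < P.@[fun i => x ord0 i]]
| semialg_setU (A B : set 'rV[R]_m) :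
    semialgebraic A -> semialgebraic B -> semialgebraic (A `|` B)
| semialg_setI (A B : set 'rV[R]_m) :
    semialgebraic A -> semialgebraic B -> semialgebraic (A `&` B)
| semialg_setC (A : set 'rV[R]_m) :
    semialgebraic A -> semialgebraic (~` A).

Definition complex_coords (R : realType) (z : R[i]) : 'rV[R]_2 :=
  \row_(k < 2) if k == ord0 then complex.Re z else complex.Im z.

Definition semialgebraicC (R : realType) (B : set R[i]) : Prop :=
  semialgebraic [set complex_coords z | z in B].

Definition monic_poly (R : realType) (n : nat) (a : 'rV[R]_n) : {poly R} :=
  'X^n + \sum_(k < n) a ord0 k *: 'X^k.

Definition coef_set (R : realType) (n : nat) (B : set R[i]) : set 'rV[R]_n :=
  [set a | forall z : R[i],
     root (map_poly (real_complex R) (monic_poly a)) z -> B z].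

Arguments coef_set [R] n B%_classical_set_scope _.

(* Main.v *)
Require Import Defs.
From mathcomp Require Import all_boot all_order all_algebra.
From mathcomp Require Import mpoly.
From mathcomp Require Import complex.
From mathcomp Require Import classical_sets reals.
From mathcomp Require Import ordered_qelim.
From mathcomp Require qe_rcf.

(** A complex number [x + iy] is a root of the polynomial with coefficients [a]
if and only if two real polynomials in [a], [x], [y] vanish, namely the real and
imaginary parts of its value.  Membership of [x + iy] in [B] is a Boolean
combination of polynomial inequalities in [x], [y].  Hence
<<
  forall x y, a polynomial in z has z = x + iy as a root  ==>  z is in B
>>
is a first-order formula over the ordered field [R] in the free variables [a].
A real type is a real closed field, so by the Tarski-Seidenberg theorem this
formula is equivalent to a quantifier-free one, and a quantifier-free formula
describes a Boolean combination of sets [0 < P].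

Two translations join the semialgebraic sets of rows to the formulas, which are
interpreted in sequences of reals: [semialgebraic_holds] writes membership of a
tuple of terms in a semialgebraic set as a formula, and [holds_semialgebraic]
eliminates the quantifiers of a formula and reads off the semialgebraic set.
The remaining point, [cterm_root], is that evaluating a polynomial at a complex
number is polynomial in the real and imaginary parts. *)

Set Implicit Arguments.
Unset Strict Implicit.
Unset Printing Implicit Defensive.

Import Order.TTheory GRing.Theory Num.Theory.

Local Open Scope ring_scope.
Local Open Scope classical_set_scope.
Local Open Scope complex_scope.

(** * Functions given by terms *)

Section TermFunctions.
Variable R : realType.
Implicit Types (g h : seq R -> R) (G H : seq R -> R[i]).

Definition term_fun g := exists t : GRing.term R, forall e, GRing.eval e t = g e.

Lemma term_fun_const (c : R) : term_fun (fun=> c).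
Proof. by exists (GRing.Const c). Qed.

Lemma term_fun_nth k : term_fun (fun e => e`_k).
Proof. by exists (GRing.Var R k). Qed.

Lemma term_funD g h : term_fun g -> term_fun h -> term_fun (fun e => g e + h e).
Proof. by move=> [t gt] [u hu]; exists (GRing.Add t u) => e /=; rewrite gt hu. Qed.

Lemma term_funN g : term_fun g -> term_fun (fun e => - g e).
Proof. by move=> [t gt]; exists (GRing.Opp t) => e /=; rewrite gt. Qed.

Lemma term_funM g h : term_fun g -> term_fun h -> term_fun (fun e => g e * h e).
Proof. by move=> [t gt] [u hu]; exists (GRing.Mul t u) => e /=; rewrite gt hu. Qed.

Lemma term_funX g k : term_fun g -> term_fun (fun e => g e ^+ k).
Proof. by move=> [t gt]; exists (GRing.Exp t k) => e /=; rewrite gt. Qed.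

Lemma term_fun_meval m (P : {mpoly R[m]}) (g : 'I_m -> seq R -> R) :
  (forall i, term_fun (g i)) -> term_fun (fun e => P.@[fun i => g i e]).
Proof.
move=> gT.
suff: term_fun (fun e => \sum_(k <- msupp P) P@_k * \prod_i g i e ^+ k i).
  by move=> [t tE]; exists t => e; rewrite tE mevalE.
elim: (msupp P) => [|k s [t tE]].
  by have [t tE] := term_fun_const 0; exists t => e; rewrite tE big_nil.
suff kT: term_fun (fun e => P@_k * \prod_i g i e ^+ k i).
  have [u uE] := term_funD kT (ex_intro _ t tE).
  by exists u => e; rewrite uE big_cons.
apply/term_funM; first exact: term_fun_const.
elim: (index_enum _) => [|i r [u uE]].
  by have [u uE] := term_fun_const 1; exists u => e; rewrite uE big_nil.
have [v vE] := term_funM (term_funX (k i) (gT i)) (ex_intro _ u uE).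
by exists v => e; rewrite vE big_cons.
Qed.

Definition cterm_fun G :=
  term_fun (fun e => complex.Re (G e)) /\ term_fun (fun e => complex.Im (G e)).

Lemma cterm_fun_real g : term_fun g -> cterm_fun (fun e => (g e)%:C).
Proof. by move=> gT; split=> //; exact: term_fun_const. Qed.

Lemma cterm_funD G H :
  cterm_fun G -> cterm_fun H -> cterm_fun (fun e => G e + H e).
Proof.
move=> [Gr Gi] [Hr Hi]; split.
  have [t tE] := term_funD Gr Hr; exists t => e; rewrite tE.
  by case: (G e) (H e) => ? ? [].
have [t tE] := term_funD Gi Hi; exists t => e; rewrite tE.
by case: (G e) (H e) => ? ? [].
Qed.

Lemma cterm_funM G H :
  cterm_fun G -> cterm_fun H -> cterm_fun (fun e => G e * H e).
Proof.
move=> [Gr Gi] [Hr Hi]; split.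
  have [t tE] := term_funD (term_funM Gr Hr) (term_funN (term_funM Gi Hi)).
  by exists t => e; rewrite tE; case: (G e) (H e) => ? ? [].
have [t tE] := term_funD (term_funM Gr Hi) (term_funM Gi Hr).
by exists t => e; rewrite tE; case: (G e) (H e) => ? ? [].
Qed.

Lemma cterm_funX G k : cterm_fun G -> cterm_fun (fun e => G e ^+ k).
Proof.
move=> GT; elim: k => [|k IHk]; first exact/cterm_fun_real/term_fun_const.
have [[t tE] [u uE]] := cterm_funM GT IHk.
by split; [exists t | exists u] => e; rewrite exprS ?tE ?uE.
Qed.

Lemma cterm_fun_sum (I : Type) (r : seq I) (G : I -> seq R -> R[i]) :
  (forall i, cterm_fun (G i)) -> cterm_fun (fun e => \sum_(i <- r) G i e).
Proof.
move=> GT; elim: r => [|i r IHr].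
  have [[t tE] [u uE]] := cterm_fun_real (term_fun_const 0).
  by split; [exists t | exists u] => e; rewrite big_nil ?tE ?uE.
have [[t tE] [u uE]] := cterm_funD (GT i) IHr.
by split; [exists t | exists u] => e; rewrite big_cons ?tE ?uE.
Qed.

End TermFunctions.

(** * Semialgebraic sets and formulas *)

Section Formulas.
Variable R : realType.

(** The arbitrary functions [g], in place of the variables themselves, make
room for substitution: the two coordinates of a point of [B] will not be the
first two variables. *)
Lemma semialgebraic_holds m (A : set 'rV[R]_m) (g : 'I_m -> seq R -> R) :
    (forall i, term_fun (g i)) -> semialgebraic A ->
  exists f : ord.formula R, forall e, ord.holds e f <-> A (\row_i g i e).
Proof.
move=> gT; elim=> {A} [P|A B _ [f fE] _ [h hE]|A B _ [f fE] _ [h hE]|A _ [f fE]].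
- have [t tE] := term_fun_meval P gT.
  exists (ord.Lt (GRing.Const 0) t) => e /=; rewrite tE.
  rewrite (@meval_eq _ _ (fun i => (\row_i g i e) ord0 i) (g^~ e)) // => i.
  by rewrite mxE.
- by exists (ord.Or f h) => e /=; rewrite fE hE.
- by exists (ord.And f h) => e /=; rewrite fE hE.
- by exists (ord.Not f) => e /=; rewrite fE.
Qed.

Definition row_env n (a : 'rV[R]_n) : seq R := [seq a ord0 i | i <- enum 'I_n].

Lemma nth_row_env n (a : 'rV[R]_n) (i : 'I_n) : (row_env a)`_i = a ord0 i.
Proof. by rewrite (nth_map i) ?size_enum_ord // nth_ord_enum. Qed.

Lemma eval_row_env_mpoly n (t : GRing.term R) : GRing.rterm t ->
  exists P : {mpoly R[n]},
    forall a, GRing.eval (row_env a) t = P.@[fun i => a ord0 i].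
Proof.
elim: t => //=.
- move=> k _; case: (ltnP k n) => [kn|nk].
    by exists 'X_(Ordinal kn) => a; rewrite mevalXU -nth_row_env.
  (* a variable past the end of the row reads the default value *)
  exists 0 => a; rewrite meval0 nth_default //.
  by rewrite size_map size_enum_ord.
- by move=> c _; exists c%:MP => a; rewrite mevalC.
- by move=> k _; exists (k%:R)%:MP => a; rewrite mevalC.
- move=> t IHt u IHu /andP[/IHt[P PE] /IHu[Q QE]].
  by exists (P + Q) => a; rewrite mevalD PE QE.
- by move=> t IHt /IHt[P PE]; exists (- P) => a; rewrite mevalN PE.
- by move=> t IHt k /IHt[P PE]; exists (P *+ k) => a; rewrite mevalMn PE.
- move=> t IHt u IHu /andP[/IHt[P PE] /IHu[Q QE]].
  by exists (P * Q) => a; rewrite mevalM PE QE.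
- by move=> t IHt k /IHt[P PE]; exists (P ^+ k) => a; rewrite rmorphXn /= PE.
Qed.

Lemma qf_eval_semialgebraic n (f : ord.formula R) :
    ord.qf_form f -> ord.rformula f ->
  semialgebraic [set a : 'rV[R]_n | ord.qf_eval (row_env a) f].
Proof.
have lt_semialg t u : GRing.rterm t -> GRing.rterm u ->
    semialgebraic [set a : 'rV[R]_n |
      GRing.eval (row_env a) t < GRing.eval (row_env a) u].
  move=> /(eval_row_env_mpoly n)[P PE] /(eval_row_env_mpoly n)[Q QE].
  rewrite (_ : mkset _ = [set a : 'rV[R]_n | 0 < (Q - P).@[fun i => a ord0 i]]).
    exact: semialg_pos.
  by apply/seteqP; split=> a /=; rewrite PE QE mevalB subr_gt0.
have le_semialg t u : GRing.rterm t -> GRing.rterm u ->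
    semialgebraic [set a : 'rV[R]_n |
      GRing.eval (row_env a) t <= GRing.eval (row_env a) u].
  move=> tR uR; have := semialg_setC (lt_semialg u t uR tR).
  congr (semialgebraic _); apply/seteqP.
  by split=> a /=; rewrite leNgt => /negP.
elim: f => //=.
- move=> b _ _; have := @semialg_pos R n b%:R.
  congr (semialgebraic _); apply/seteqP.
  by split=> a /=; rewrite rmorph_nat ltr0n; case: b.
- move=> t u _ /andP[tR uR].
  have := semialg_setI (le_semialg t u tR uR) (le_semialg u t uR tR).
  congr (semialgebraic _); apply/seteqP; split=> a /=.
    by case=> tu ut; apply/eqP/le_anti; rewrite tu.
  by move=> /eqP ->.
- by move=> t u _ /andP[]; exact: lt_semialg.
- by move=> t u _ /andP[]; exact: le_semialg.
- move=> f IHf g IHg /andP[fq gq] /andP[fR gR].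
  have := semialg_setI (IHf fq fR) (IHg gq gR).
  by congr (semialgebraic _); apply/seteqP; split=> a /= /andP.
- move=> f IHf g IHg /andP[fq gq] /andP[fR gR].
  have := semialg_setU (IHf fq fR) (IHg gq gR).
  by congr (semialgebraic _); apply/seteqP; split=> a /= /orP.
- move=> f IHf g IHg /andP[fq gq] /andP[fR gR].
  have := semialg_setU (semialg_setC (IHf fq fR)) (IHg gq gR).
  congr (semialgebraic _); apply/seteqP; split=> a /=; rewrite implybE.
    by case=> [/negP ->|->] //; rewrite orbT.
  by case/orP => [/negP|]; [left | right].
- move=> f IHf fq fR; have := semialg_setC (IHf fq fR).
  by congr (semialgebraic _); apply/seteqP; split=> a /= /negP.
Qed.

(** This is the Tarski-Seidenberg theorem, rephrased for sets of rows.  Inverses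
must go first ([ord.to_rform]), because elimination works with the language of
ordered rings. *)
Lemma holds_semialgebraic n (f : ord.formula R) :
  semialgebraic [set a : 'rV[R]_n | ord.holds (row_env a) f].
Proof.
have fR := ord.to_rform_rformula f.
have /andP[qf qR] := ord.quantifier_elim_wf (@qe_rcf.wf_QE_wproj R) fR.
have := qf_eval_semialgebraic n qf qR; congr (semialgebraic _).
have elimP a := qe_rcf.rcf_satP (row_env a) f.
by apply/seteqP; split=> a /= /elimP.
Qed.

End Formulas.

(** * Roots of the polynomial with given coefficients *)

Section Roots.
Variable R : realType.

Lemma complex_coords_inj : injective (@complex_coords R).
Proof.
move=> [x y] [x' y'] /rowP zz'.
by have := zz' ord0; have := zz' (lift ord0 ord0); rewrite !mxE /= => -> ->.
Qed.

Lemma root_monic_poly n (a : 'rV[R]_n) (z : R[i]) :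
  root (map_poly (real_complex R) (monic_poly a)) z =
  (z ^+ n + \sum_(k < n) (a ord0 k)%:C * z ^+ k == 0).
Proof.
rewrite /root /monic_poly rmorphD /= map_polyXn rmorph_sum hornerD hornerXn.
rewrite horner_sum; congr (_ + _ == 0); apply: eq_bigr => k _ /=.
by rewrite map_polyZ /= map_polyXn hornerZ hornerXn.
Qed.

(** The variables [0], ..., [n - 1] hold the coefficients, [n] and [n + 1] the
real and imaginary parts of the point. *)
Lemma cterm_root n : cterm_fun (fun e : seq R =>
  (e`_n +i* e`_n.+1) ^+ n + \sum_(k < n) (e`_k)%:C * (e`_n +i* e`_n.+1) ^+ k).
Proof.
have zT : cterm_fun (fun e : seq R => e`_n +i* e`_n.+1).
  by split; exact: term_fun_nth.
apply: cterm_funD; first exact: cterm_funX.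
apply: cterm_fun_sum => k; apply: cterm_funM; last exact: cterm_funX.
exact/cterm_fun_real/term_fun_nth.
Qed.

End Roots.

Theorem theorem2p1 (R : realType) (B : set R[i]) (n : nat) :
  (0 < n)%N -> semialgebraicC B -> semialgebraic (coef_set n B).
Proof.
move=> _ Bsa.
pose g (k : 'I_2) (e : seq R) := if k == ord0 then e`_n else e`_n.+1.
have gT k : term_fun (g k) by rewrite /g; case: eqP => _; exact: term_fun_nth.
have [fB fBE] := semialgebraic_holds gT Bsa.
have [[u uE] [v vE]] := cterm_root R n.
have := @holds_semialgebraic R n (ord.Forall n (ord.Forall n.+1 (ord.Implies
  (ord.And (ord.Equal u (GRing.Const 0)) (ord.Equal v (GRing.Const 0))) fB))).
congr (semialgebraic _).
pose env (a : 'rV[R]_n) x y := set_nth 0 (set_nth 0 (row_env a) n x) n.+1 y.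
have envx a x y : (env a x y)`_n = x.
  by rewrite /env !nth_set_nth /= nth_set_nth /= eqxx ltn_eqF.
have envy a x y : (env a x y)`_n.+1 = y by rewrite /env nth_set_nth /= eqxx.
have enva a x y (k : 'I_n) : (env a x y)`_k = a ord0 k.
  rewrite /env nth_set_nth /= nth_set_nth /= !ltn_eqF ?nth_row_env //.
  by rewrite ltnS ltnW.
have rootE a x y : root (map_poly (real_complex R) (monic_poly a)) (x +i* y) <->
    GRing.eval (env a x y) u = 0 /\ GRing.eval (env a x y) v = 0.
  rewrite root_monic_poly uE vE envx envy.
  under [in X in _ <-> X]eq_bigr do rewrite enva.
  rewrite eq_complex /=; split=> [/andP[/eqP ? /eqP ?]|[-> ->]] //.
  by rewrite !eqxx.
have BE a x y : ord.holds (env a x y) fB <-> B (x +i* y).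
  rewrite fBE (_ : \row_k _ = complex_coords (x +i* y)); last first.
    by apply/rowP => k; rewrite !mxE /g envx envy.
  split=> [[z Bz /complex_coords_inj <-]|] //.
  by exists (x +i* y).
apply/seteqP; split=> [a holds_a [x y] /rootE xy0|a roots_B x y xy0].
  exact/BE/holds_a.
exact/BE/roots_B/rootE.
Qed.
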